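(* Let $\mu$ be a finite positive (nonzero) Borel measure on $[0,1]$. Then $$\dim_F(\mu)=\sup\{D\in[0,1): |\widehat\mu(n)|^2=O(n^{-D})\ \text{as}\ n\to\infty,\ n\in\mathbb{N}\}.$$
   Context: $\widehat{\mu}(\zeta)=\int_{[0,1]} e^{-2\pi i\zeta x}d\mu(x)$ for $\zeta\in\mathbb{R}$, and $\dim_F(\mu)=\sup\{D\in[0,1]: |\widehat{\mu}(\zeta)|^2=O(|\zeta|^{-D})\text{ as }|\zeta|\to\infty,\ \zeta\in\mathbb{R}\}$. No assumption is made on the support of $\mu$ inside $[0,1]$. *)

(* Defs.v *)
From HB Require Import structures.
From mathcomp Require Import all_boot all_order all_algebra.
From mathcomp Require Import all_classical all_reals all_analysis.
From mathcomp Require Import complex.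

Set Implicit Arguments.
Unset Strict Implicit.
Unset Printing Implicit Defensive.

Import Order.TTheory GRing.Theory Num.Theory.
Import numFieldNormedType.Exports.

Local Open Scope classical_set_scope.
Local Open Scope complex_scope.
Local Open Scope ring_scope.

(* The library's Lebesgue integral is real-valued; a complex function is
   integrated componentwise. *)
Definition cintegral d (T : measurableType d) (R : realType)
    (mu : {measure set T -> \bar R}) (A : set T) (f : T -> R[i]) : R[i] :=
  (\int[mu]_(x in A) complex.Re (f x)) +i* (\int[mu]_(x in A) complex.Im (f x)).

(* exp(i t) for t real *)
Definition expi (R : realType) (t : R) : R[i] := cos t +i* sin t.

Definition fourier (R : realType) (mu : {measure set R -> \bar R}) (z : R)
    : R[i] :=
  cintegral mu `[0, 1] (fun x : R => expi (- (2 * pi * z * x))).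

(* |mu^(z)|^2, taken in R because the norm of R[i] is R[i]-valued *)
Definition fourier_sqr (R : realType) (mu : {measure set R -> \bar R}) (z : R)
    : R :=
  ComplexField.Normc.normc (fourier mu z) ^+ 2.

(* The filter |x| -> oo on R *)
Definition norm_infty {R : realType} : set_system R :=
  filter_from setT (fun M : R => [set x | M <= `|x|]).

#[global] Instance proper_norm_infty (R : realType) :
  ProperFilter (@norm_infty R).
Proof.
apply: filter_from_proper; last first.
  by move=> M _; exists `|M|; rewrite /= normr_id ler_norm.
apply: filter_from_filter; first by exists 0.
move=> M N _ _; exists (Num.max M N) => // x /=.
by rewrite ge_max => /andP[].
Qed.

Canonical norm_infty_filter (R : realType) :=
  FilterType (@norm_infty R) filter_filter.

Definition fourier_dim (R : realType) (mu : {measure set R -> \bar R}) : R :=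
  sup [set D : R | 0 <= D <= 1 /\
    fourier_sqr mu =O_ norm_infty (fun z : R => `|z| `^ (- D))].

(* Main.v *)
Require Import Defs.
From HB Require Import structures.
From mathcomp Require Import all_boot all_order all_algebra.
From mathcomp Require Import all_classical all_reals all_analysis.
From mathcomp Require Import measurable_realfun ring lra.
Import Order.TTheory GRing.Theory Num.Theory.
Import numFieldNormedType.Exports.
Local Open Scope classical_set_scope.
Local Open Scope ring_scope.

(** Only the passage from integer to real frequencies needs an argument, and a
    logarithmic loss in it does not change the supremum.  Let s = D/2 and
    |mu^(m)| <= C (1+|m|)^(-s) for all integers m.  For z = n + th with
    0 <= th <= 1 and e(t) = exp(2 pi i t), the function e(-th x) has a jump on
    the circle R/Z.  Replace it by the trigonometric polynomial of degree
    < N = n^4 obtained by sampling it at the points j/(2N) and summing against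
    the Fejer kernel F_N.  By a geometric sum its k-th coefficient is
    O(1/(1+|k|)), so its integral against e(-n x) dmu is O(n^(-s) log n).  On [0,1] the approximation error is
    O(1/n) at distance at least 1/(8n) from the jump, and O(1) nearer to it,
    where F_n >= n/2; hence it is at most (4/n) F_n + O(1/n).  The integral of
    F_n/n is an average of the values mu^(a-b), a, b < n, which is
    O(n^(-s) log n) as well. *)

(** * Trigonometric sums and elementary bounds for sine and cosine *)

Lemma cosD2pin (R : realType) (x : R) (n : nat) :
  cos (x + 2 * pi * n%:R) = cos x.
Proof. by rewrite mulr_natr mulr_natl periodicn//; exact: cosD2pi. Qed.

Lemma sinD2pin (R : realType) (x : R) (n : nat) :
  sin (x + 2 * pi * n%:R) = sin x.
Proof. by rewrite mulr_natr mulr_natl periodicn//; exact: sinD2pi. Qed.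

(** Multiplying by [2 * sin b] makes the sum telescope; the factor stays on the left because [sin b]
    may vanish. *)
Lemma sum_cos_arith (R : realType) (x b : R) (N : nat) :
  2 * sin b * \sum_(a < N) cos (x + 2 * b * a%:R) =
  sin (x + b * (2 * N%:R - 1)) - sin (x - b).
Proof.
elim: N => [|N IH]; first by rewrite big_ord0 mulr0 mulr0 sub0r mulrN1 subrr.
rewrite big_ord_recr/= mulrDr IH.
have -> : x + b * (2 * N.+1%:R - 1) = (x + 2 * b * N%:R) + b.
  by rewrite -natr1; ring.
have -> : x + b * (2 * N%:R - 1) = (x + 2 * b * N%:R) - b by ring.
by rewrite (sinB (x + _)) (sinD _ b); ring.
Qed.

Lemma cos_piquarter (R : realType) :
  0 < cos (pi / 4) :> R /\ cos (pi / 4) ^+ 2 = 1 / 2 :> R.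
Proof.
have pp := pi_gt0 R; split; first by apply: cos_gt0_pihalf; lra.
have := cos_mulr2n (pi / 4 : R).
have -> : pi / 4 *+ 2 = pi / 2 :> R by rewrite mulr2n; lra.
by rewrite cos_pihalf mulr2n; lra.
Qed.

(** With [c] in []0, y / 2[] given by the mean value theorem, [sin y = 2 cos (y / 2) sin (y / 2) = y
    cos (y / 2) cos c]. Both cosines are at least [cos (pi / 4)], whose square is 1/2. *)
Lemma sin_ge_half (R : realType) (y : R) : 0 <= y <= pi / 2 -> y / 2 <= sin y.
Proof.
move=> /andP[]; rewrite le_eqVlt => /predU1P[<-|y0 yp].
  by rewrite mul0r sin0.
have hd (z : R) : z \in `]0, y / 2[ -> is_derive z 1 (@sin R) (cos z).
  by move=> _; exact: is_derive_sin.
have [c ci] := MVT (divr_gt0 y0 (ltr0Sn _ 1)) hd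
  (continuous_subspaceT (@continuous_sin R)).
rewrite sin0 !subr0 => hs.
move: ci; rewrite in_itv/= => /andP[c0 cy].
have cosi : cos (pi / 4) <= cos (y / 2) :> R.
  have p0 := pi_gt0 R.
  by rewrite leNgt ltr_cos ?in_itv/= -?leNgt; lra.
have cosc : cos (y / 2) <= cos c.
  have p0 := pi_gt0 R.
  by rewrite leNgt ltr_cos ?in_itv/= -?leNgt; lra.
have p0 := pi_gt0 R.
have [c4 c42] := cos_piquarter R.
have -> : sin y = (cos (y / 2) * sin (y / 2)) *+ 2.
  by rewrite -sin_mulr2n; congr sin; rewrite mulr2n; lra.
rewrite hs [leRHS]mulr2n.
have h1 : cos (pi / 4) ^+ 2 <= cos (y / 2) * cos c.
  by rewrite expr2 ler_pM// ?(ltW c4)// (le_trans cosi).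
rewrite c42 in h1.
have y20 : 0 <= y / 2 by lra.
have := ler_wpM2r y20 h1.
move: (cos (y / 2)) (cos c) => u v; lra.
Qed.

Lemma norm_sin_ge_half (R : realType) (y : R) :
  `|y| <= pi / 2 -> `|y| / 2 <= `|sin y|.
Proof.
move=> h; apply: le_trans (_ : sin `|y| <= _).
  by apply: sin_ge_half; rewrite normr_ge0.
by case: (ger0P y) => _; rewrite ?ler_norm// sinN -normrN ler_norm.
Qed.

Lemma norm_cosB (R : realType) (x y : R) : `|cos x - cos y| <= `|x - y|.
Proof.
wlog xy : x y / x <= y.
  move=> H; case: (leP x y) => [/H//|/ltW /H].
  by rewrite distrC (distrC x).
have hd (z : R) : z \in `]x, y[ -> is_derive z 1 (@cos R) (- sin z).
  by move=> _; exact: is_derive_cos.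
have [c _ h] := MVT_segment xy hd (continuous_subspaceT (@continuous_cos R)).
rewrite distrC h (distrC x) normrM normrN -[leRHS]mul1r ler_wpM2r//.
exact: sin_max.
Qed.

(** * Decay weights and harmonic sums *)

(** The added 1 keeps the weight finite and positive at frequency 0, so that one bound serves all
    integers. *)
Definition recip1 {R : realType} (y : R) : R := (1 + `|y|)^-1.
Definition harm {R : realType} (N : nat) : R := \sum_(i < N) i.+1%:R^-1.

Lemma recip1_gt0 (R : realType) (y : R) : 0 < recip1 y.
Proof. by rewrite invr_gt0 ltr_wpDr. Qed.

Lemma recip1_le1 (R : realType) (y : R) : recip1 y <= 1.
Proof.
have p : 0 < 1 + `|y| by rewrite ltr_wpDr.
by rewrite /recip1 invf_le1// lerDl.
Qed.

Lemma recip1_far (R : realType) (y : R) (N : nat) :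
  N%:R / 2 <= `|y| -> recip1 y <= 2 * N.+1%:R^-1.
Proof.
move=> h.
have p : 0 < 1 + `|y| by rewrite ltr_wpDr.
rewrite -[leRHS]invrK lef_pV2 ?posrE// ?invr_gt0 ?mulr_gt0 ?invr_gt0//.
by rewrite invfM invrK -[N.+1%:R]natr1; lra.
Qed.

(* Induction on [N], discarding the index farthest from [c]. *)
Lemma sum_recip1_le (R : realType) (N : nat) (c : R) :
  \sum_(a < N) recip1 (a%:R - c) <= 2 * harm N.
Proof.
elim: N c => [|N IH] c; first by rewrite /harm !big_ord0 mulr0.
rewrite /harm [X in _ <= _ * X]big_ord_recr/= mulrDr.
have N0 : 0 <= N%:R :> R by [].
case: (leP c (N%:R / 2)) => hc.
  rewrite big_ord_recr/= lerD//.
  by apply: recip1_far; rewrite ger0_norm; lra.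
rewrite big_ord_recl/= addrC lerD//.
  apply: le_trans (IH (c - 1)); apply: ler_sum => i _.
  by rewrite /bump add1n -natr1 opprB addrA addrAC.
by apply: recip1_far; rewrite sub0r normrN ger0_norm; lra.
Qed.

(** The induction step is [ln (1 - u) <= - u] at [u = 1 / (N + 2)], where [1 - u] is a ratio of
    consecutive integers. *)
Lemma harm_le_ln (R : realType) (N : nat) : (0 < N)%N ->
  harm N <= 1 + ln N%:R :> R.
Proof.
elim: N => // -[|N] IH _; first by rewrite /harm big_ord1 ln1 invr1 addr0.
rewrite /harm big_ord_recr/= -/(harm N.+1).
apply: le_trans (lerD (IH isT) (lexx _)) _.
rewrite -addrA lerD2l.
have p1 : 0 < N.+1%:R :> R by rewrite ltr0n.
have p2 : 0 < N.+2%:R :> R by rewrite ltr0n.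
have := @le_ln1Dx R (- N.+2%:R^-1).
have -> : 1 - N.+2%:R^-1 = N.+1%:R / N.+2%:R :> R.
  by apply: (mulIf (lt0r_neq0 p2)); rewrite mulrBl mulfVK ?lt0r_neq0// mulVf ?lt0r_neq0// -[in LHS]natr1; ring.
rewrite ln_div ?posrE// => H.
have /H : - 1 < - N.+2%:R^-1 :> R by rewrite ltrN2 invf_lt1// ltr1n.
by move: (ln _) (ln _) (_^-1) => u v w; lra.
Qed.

Lemma harm_ge1 (R : realType) (N : nat) : (0 < N)%N -> 1 <= harm N :> R.
Proof.
case: N => // N _; rewrite /harm big_ord_recl invr1 lerDl.
by apply: sumr_ge0 => i _; rewrite invr_ge0.
Qed.

Lemma le_harm (R : realType) (M N : nat) : (M <= N)%N -> harm M <= harm N :> R.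
Proof.
move=> /subnKC <-; elim: (N - M)%N => [|k IH]; first by rewrite addn0.
by rewrite addnS; apply: le_trans IH _; rewrite /harm big_ord_recr/= lerDl invr_ge0.
Qed.

(** * Fejer kernel *)

(** This is the sum over [|k| < N] of [(1 - |k| / N) exp (2 pi i k t)], with value [N] at 0. In
    double-sum form its integral is directly an average of coefficients at [a - b]. *)
Definition fejer {R : realType} (N : nat) (t : R) : R :=
  N%:R^-1 * \sum_(a < N) \sum_(b < N) cos (2 * pi * (a%:R - b%:R) * t).

(** The addition formula separates [a] from [b], leaving the squared modulus of an exponential sum;
    positivity becomes visible. *)
Lemma fejerE (R : realType) (N : nat) (t : R) :
  fejer N t = N%:R^-1 * ((\sum_(a < N) cos (2 * (pi * t) * a%:R)) ^+ 2
                         + (\sum_(a < N) sin (2 * (pi * t) * a%:R)) ^+ 2).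
Proof.
rewrite /fejer !expr2 !big_distrlr/= -big_split/=; congr (_ * _).
apply: eq_bigr => a _; rewrite -big_split/=; apply: eq_bigr => b _.
by rewrite -cosB; congr cos; ring.
Qed.

Lemma fejer_ge0 (R : realType) (N : nat) (t : R) : 0 <= fejer N t.
Proof. by rewrite fejerE mulr_ge0 ?invr_ge0// addr_ge0 ?sqr_ge0. Qed.

(** The kernel is even and 1-periodic. This carries the lower bound near 0 over to the other
    endpoint 1. *)
Lemma fejer1B (R : realType) (N : nat) (t : R) : fejer N (1 - t) = fejer N t.
Proof.
congr (_ * _); apply: eq_bigr => a _; apply: eq_bigr => b _.
rewrite -(cosD2pin _ _ b) -(cosN (2 * pi * _ * t)) -(cosD2pin _ (- _) a).
by congr cos; ring.
Qed.

(** The closed form of the kernel is [sin (pi N t) ^ 2 / (N sin (pi t) ^ 2)]; here the numerator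
    appears as [2 - 2 cos (2 N b)], up to a factor 4. *)
Lemma sin2_fejer_le (R : realType) (N : nat) (t : R) :
  sin (pi * t) ^+ 2 * fejer N t <= N%:R^-1.
Proof.
rewrite fejerE mulrCA ler_piMr ?invr_ge0//.
set b := pi * t; set C := \sum_(a < N) cos _; set S := \sum_(a < N) sin _.
have hC : 2 * sin b * C = sin (b * (2 * N%:R - 1)) + sin b.
  have := sum_cos_arith R 0 b N; rewrite add0r sub0r sinN opprK => <-.
  by congr (_ * _); apply: eq_bigr => a _; rewrite add0r.
have hS : 2 * sin b * S = cos b - cos (b * (2 * N%:R - 1)).
  have := sum_cos_arith R (- (pi / 2)) b N.
  rewrite (addrC (- (pi / 2)) (b * _)) sinBpihalf -(opprD (pi / 2)) sinN (addrC (pi / 2)).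
  rewrite sinDpihalf opprK (addrC (- _)) => <-.
  by congr (_ * _); apply: eq_bigr => a _; rewrite (addrC (- (pi / 2))) cosBpihalf.
have : 4 * (sin b ^+ 2 * (C ^+ 2 + S ^+ 2)) = 2 - 2 * cos (b * (2 * N%:R - 1) + b).
  transitivity ((2 * sin b * C) ^+ 2 + (2 * sin b * S) ^+ 2); first ring.
  rewrite hC hS cosD.
  have := cos2Dsin2 b; have := cos2Dsin2 (b * (2 * N%:R - 1)).
  move: (cos b) (sin b) (cos _) (sin _) => c s c' s' e1 e2.
  transitivity ((c' ^+ 2 + s' ^+ 2) + (c ^+ 2 + s ^+ 2) - 2 * (c' * c - s' * s)).
    by ring.
  by rewrite e1 e2; ring.
have := cos_geN1 (b * (2 * N%:R - 1) + b).
by move: (cos _) (sin b ^+ 2 * _) => u v; lra.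
Qed.

(** After [M] steps the angle has advanced by [p] full turns, so the two sines in [sum_cos_arith]
    cancel, while [0 < p < M] keeps [sin b] nonzero. *)
Lemma sum_cos_roots (R : realType) (y : R) (p M : nat) : (0 < p < M)%N ->
  \sum_(j < M) cos (y + 2 * (pi * p%:R / M%:R) * j%:R) = 0.
Proof.
move=> /andP[p0 pM].
have M0 : 0 < M%:R :> R by rewrite ltr0n (leq_trans _ pM).
have pp := pi_gt0 R.
set b := pi * p%:R / M%:R.
have sb : 0 < sin b.
  apply: sin_gt0_pi; apply/andP; split.
    by rewrite divr_gt0// mulr_gt0// ltr0n.
  by rewrite ltr_pdivrMr// ltr_pM2l// ltr_nat.
have := sum_cos_arith R y b M.
have -> : y + b * (2 * M%:R - 1) = (y - b) + 2 * pi * p%:R.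
  by rewrite /b; field; rewrite lt0r_neq0.
rewrite sinD2pin subrr => /eqP; rewrite mulf_eq0 mulf_eq0.
by rewrite (negbTE (lt0r_neq0 sb)) pnatr_eq0/= => /eqP.
Qed.

(** Since [|a - b| < N <= M], no nonzero frequency is a multiple of [M], and only the diagonal
    survives the sum over the nodes. Divided by [M], the kernel values are thus weights of total
    mass exactly 1. *)
Lemma sum_fejer (R : realType) (x : R) (N M : nat) : (0 < N <= M)%N ->
  \sum_(j < M) fejer N (x - j%:R / M%:R) = M%:R.
Proof.
move=> /andP[N0 NM].
have MR0 : 0 < M%:R :> R by rewrite ltr0n (leq_trans N0).
have NR0 : 0 < N%:R :> R by rewrite ltr0n.
rewrite /fejer -mulr_sumr exchange_big/=.
have diag (a : 'I_N) : \sum_(j < M) \sum_(b < N)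
    cos (2 * pi * (a%:R - b%:R) * (x - j%:R / M%:R)) = M%:R.
  rewrite exchange_big/= (bigD1 a)//= [X in _ + X]big1 ?addr0.
    under eq_bigr do rewrite subrr mulr0 mul0r cos0.
    by rewrite sumr_const card_ord.
  move=> b ba.
  have [ab|ab] := ltnP b a.
    have h : (0 < a - b < M)%N.
      by rewrite subn_gt0 ab (leq_ltn_trans (leq_subr _ _))// (leq_trans (ltn_ord a)).
    rewrite -[RHS](sum_cos_roots R (- (2 * pi * (a - b)%:R * x)) _ _ h).
    apply: eq_bigr => j _; rewrite -cosN natrB ?(ltnW ab)//; congr cos.
    by ring.
  have lab : (a < b)%N by rewrite ltn_neqAle ab andbT eq_sym.
  have h : (0 < b - a < M)%N.
    by rewrite subn_gt0 lab (leq_ltn_trans (leq_subr _ _))// (leq_trans (ltn_ord b)).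
  rewrite -[RHS](sum_cos_roots R (- (2 * pi * (b - a)%:R * x)) _ _ h).
  by apply: eq_bigr => j _; rewrite natrB//; congr cos; ring.
under eq_bigr do rewrite diag.
by rewrite sumr_const card_ord -[M%:R *+ N]mulr_natl mulKf ?lt0r_neq0.
Qed.

(** All angles are at most [pi / 4] in absolute value, so the cosine sum alone is at least
    [N cos (pi / 4)], and its square is at least [N ^ 2 / 2]. *)
Lemma fejer_ge (R : realType) (N : nat) (t : R) : (0 < N)%N ->
  `|t| <= (8 * N%:R)^-1 -> N%:R / 2 <= fejer N t.
Proof.
move=> N0 ht.
have NR0 : 0 < N%:R :> R by rewrite ltr0n.
have pp := pi_gt0 R.
have [c4 c42] := cos_piquarter R.
have hC : N%:R * cos (pi / 4) <= \sum_(a < N) cos (2 * (pi * t) * a%:R).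
  have -> : N%:R * cos (pi / 4) = \sum_(a < N) cos (pi / 4) :> R.
    by rewrite sumr_const card_ord mulr_natl.
  apply: ler_sum => a _.
  have h : `|2 * (pi * t) * a%:R| <= pi / 4.
    rewrite 3!normrM normr_nat (ger0_norm (ltW pp)) normr_nat.
    have aN : a%:R <= N%:R :> R by rewrite ler_nat ltnW.
    have : `|t| * a%:R <= (8 * N%:R)^-1 * N%:R by rewrite ler_pM.
    rewrite invfM mulfVK ?lt0r_neq0// => h8.
    have := ler_wpM2l (ltW pp) h8.
    by rewrite -!mulrA; lra.
  have h0 := normr_ge0 (2 * (pi * t) * a%:R).
  by rewrite -(cos_norm (2 * _ * _)) leNgt ltr_cos ?in_itv/= -?leNgt; lra.
rewrite fejerE.
apply: le_trans (_ : N%:R^-1 * (N%:R * cos (pi / 4)) ^+ 2 <= _).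
  by rewrite exprMn c42 expr2 mulrA mulKf ?lt0r_neq0// div1r.
rewrite ler_wpM2l ?invr_ge0//.
apply: le_trans (_ : (\sum_(a < N) cos (2 * (pi * t) * a%:R)) ^+ 2 <= _).
  by rewrite ler_sqr ?nnegrE// ?mulr_ge0 ?(ltW c4)// (le_trans _ hC)// mulr_ge0 ?(ltW c4).
by rewrite lerDl sqr_ge0.
Qed.

(** The sine double sum is antisymmetric in [a] and [b], hence zero, so the addition formula can
    absorb the phase [u] into each term. *)
Lemma cosM_fejer (R : realType) (N : nat) (u t : R) :
  cos u * fejer N t =
  N%:R^-1 * \sum_(a < N) \sum_(b < N) cos (u + 2 * pi * (a%:R - b%:R) * t).
Proof.
rewrite /fejer mulrCA; congr (_ * _).
have s0 : \sum_(a < N) \sum_(b < N) sin (2 * pi * (a%:R - b%:R) * t) = 0.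
  set S := LHS.
  have : S = - S.
    rewrite {1}/S exchange_big/= /S -sumrN; apply: eq_bigr => a _.
    rewrite -sumrN; apply: eq_bigr => b _.
    by rewrite -sinN; congr sin; ring.
  lra.
transitivity (cos u * (\sum_(a < N) \sum_(b < N) cos (2 * pi * (a%:R - b%:R) * t))
  - sin u * (\sum_(a < N) \sum_(b < N) sin (2 * pi * (a%:R - b%:R) * t))).
  by rewrite s0 mulr0 subr0.
rewrite !mulr_sumr -sumrB; apply: eq_bigr => a _.
by rewrite !mulr_sumr -sumrB; apply: eq_bigr => b _; rewrite cosD.
Qed.

(** * Approximation by Fejer sums over equally spaced nodes *)

(** Compares distance on the line with distance on the circle. Up to 1/2 the sine is at least [|t|];
    beyond it, reflection gives at least [1 - |t| >= d]. *)
Lemma norm_sinpi_ge (R : realType) (d t : R) : 0 < d <= 1 -> `|t| <= 1 - d ->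
  d * `|t| <= `|sin (pi * t)|.
Proof.
move=> /andP[d0 d1] ht.
have t0 := normr_ge0 t.
have p2 := pi_ge2 R.
have [t2|t2] := leP `|t| (1 / 2).
  have h : `|pi * t| <= pi / 2.
    rewrite normrM ger0_norm; last lra.
    have : pi * `|t| <= pi * (1 / 2) by rewrite ler_wpM2l//; lra.
    lra.
  apply: le_trans (norm_sin_ge_half R _ h).
  rewrite normrM (@ger0_norm _ pi); last lra.
  apply: le_trans (_ : 1 * `|t| <= _); first by rewrite ler_wpM2r.
  by rewrite mulrAC ler_wpM2r//; lra.
have hb : 0 <= pi * (1 - `|t|) <= pi / 2.
  rewrite mulr_ge0/=; [|lra|lra].
  by rewrite ler_wpM2l//; lra.
have := sin_ge_half R _ hb.
have -> : sin (pi * (1 - `|t|)) = sin (pi * `|t|).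
  have -> : pi * (1 - `|t|) = - (pi * `|t|) + pi by ring.
  by rewrite sinDpi sinN opprK.
have : sin (pi * `|t|) <= `|sin (pi * t)|.
  by case: (ger0P t) => _; rewrite ?ler_norm// mulrN sinN -normrN ler_norm.
have : 2 * (1 - `|t|) <= pi * (1 - `|t|) by rewrite ler_wpM2r//; lra.
have : d * `|t| <= d * 1 by rewrite ler_wpM2l//; lra.
move: (sin _) `|sin _| (pi * _) (d * `|t|) => u v w z; lra.
Qed.

(** The first moment of the kernel is reduced to the second, which [sin2_fejer_le] controls; order
    [q ^ 2] balances the two terms at [1 / q]. *)
Lemma fejer_mean_sin (R : realType) (x : R) (q M : nat) :
  (0 < q)%N -> (q ^ 2 <= M)%N ->
  M%:R^-1 * \sum_(j < M) `|sin (pi * (x - j%:R / M%:R))| * fejer (q ^ 2) (x - j%:R / M%:R)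
    <= q%:R^-1.
Proof.
move=> q0 qM.
have qR0 : 0 < q%:R :> R by rewrite ltr0n.
have MR0 : 0 < M%:R :> R by rewrite ltr0n (leq_trans _ qM)// expn_gt0 q0.
rewrite ler_pdivrMl//.
have h : \sum_(j < M) `|sin (pi * (x - j%:R / M%:R))| * fejer (q ^ 2) (x - j%:R / M%:R)
   <= \sum_(j < M) (q%:R^-1 / 2 * fejer (q ^ 2) (x - j%:R / M%:R) + q%:R^-1 / 2).
  apply: ler_sum => j _; set t := x - _.
  have f0 := fejer_ge0 R (q ^ 2) t; have s2 := sin2_fejer_le R (q ^ 2) t.
  (* AM-GM: [2 |s| <= 1/q + q s^2] *)
  have amgm : 2 * `|sin (pi * t)| <= q%:R^-1 + q%:R * sin (pi * t) ^+ 2.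
    rewrite -real_normK ?num_real//.
    have := mulr_ge0 (ltW qR0) (sqr_ge0 (`|sin (pi * t)| - q%:R^-1)).
    have -> : q%:R * (`|sin (pi * t)| - q%:R^-1) ^+ 2 =
      q%:R * `|sin (pi * t)| ^+ 2 - 2 * `|sin (pi * t)| + q%:R^-1.
      by field; rewrite lt0r_neq0.
    by move: (q%:R^-1) => w; lra.
  have h1 := ler_wpM2r f0 amgm.
  have h2 : q%:R * (sin (pi * t) ^+ 2 * fejer (q ^ 2) t) <= q%:R^-1.
    apply: le_trans (ler_wpM2l (ltW qR0) s2) _.
    by rewrite natrX expr2 invfM mulVKf ?lt0r_neq0.
  rewrite [leRHS]mulrDl -(mulrA q%:R) in h1.
  move: h1 h2.
  move: (q%:R * (_ * _)) (q%:R^-1) `|_| => u v w; lra.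
apply: le_trans h _.
rewrite big_split/= -mulr_sumr sum_fejer ?expn_gt0 ?q0 ?qM//.
by rewrite sumr_const card_ord -[_ / 2 *+ M]mulr_natr; lra.
Qed.

(** The hypothesis on [v] is Lipschitz continuity on the line, not on the circle, so the jump sits
    at the endpoints of [[0, 1]]. At distance [1 / (8 n)] from them the comparison with the sine
    loses a factor [8 n], which order [n ^ 4] more than compensates. *)
Lemma cos_fejer_approx (R : realType) (n : nat) (x u : R) (v : nat -> R) (M : nat) :
  (0 < n)%N -> 0 <= x <= 1 -> (n ^ 4 <= M)%N ->
  (forall j, `|u - v j| <= 2 * pi * `|x - j%:R / M%:R|) ->
  `|cos u - M%:R^-1 * \sum_(j < M) cos (v j) * fejer (n ^ 4) (x - j%:R / M%:R)|
    <= 4 / n%:R * fejer n x + 64 / n%:R.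
Proof.
move=> n0 /andP[x0 x1] nM huv.
have nR0 : 0 < n%:R :> R by rewrite ltr0n.
have N0 : (0 < n ^ 4)%N by rewrite expn_gt0 n0.
have MR0 : 0 < M%:R :> R by rewrite ltr0n (leq_trans _ nM).
have F0 := fejer_ge0 R n x.
have sF : \sum_(j < M) fejer (n ^ 4) (x - j%:R / M%:R) = M%:R.
  by apply: sum_fejer; rewrite N0.
have -> : cos u - M%:R^-1 * \sum_(j < M) cos (v j) * fejer (n ^ 4) (x - j%:R / M%:R)
  = M%:R^-1 * \sum_(j < M) (cos u - cos (v j)) * fejer (n ^ 4) (x - j%:R / M%:R).
  under [in RHS]eq_bigr do rewrite mulrBl.
  by rewrite sumrB -mulr_sumr sF mulrBr mulrCA mulVf ?mulr1 ?lt0r_neq0.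
rewrite normrM ger0_norm ?invr_ge0//.
apply: le_trans (ler_wpM2l _ (ler_norm_sum _ _ _)) _; rewrite ?invr_ge0//.
under eq_bigr do rewrite normrM (ger0_norm (fejer_ge0 _ _ _)).
have d0 : 0 < (8 * n%:R)^-1 :> R by rewrite invr_gt0 mulr_gt0.
have d1 : (8 * n%:R)^-1 <= 1 :> R.
  have : 1 <= n%:R :> R by rewrite ler1n.
  by rewrite invf_le1; lra.
have [hx|hx] := boolP (((8 * n%:R)^-1 <= x) && (x <= 1 - (8 * n%:R)^-1)); last first.
  (* Near the endpoints the trivial bound 2 is absorbed by [4 / n * fejer n x]. *)
  apply: le_trans (_ : M%:R^-1 * \sum_(j < M) 2 * fejer (n ^ 4) (x - j%:R / M%:R) <= _).
    rewrite ler_wpM2l ?invr_ge0//; apply: ler_sum => j _.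
    rewrite ler_wpM2r ?fejer_ge0//.
    apply: le_trans (ler_normB _ _) _.
    by have := cos_max u; have := cos_max (v j); lra.
  rewrite -mulr_sumr sF mulrCA mulVf ?lt0r_neq0// mulr1.
  have : n%:R / 2 <= fejer n x.
    move: hx; rewrite negb_and -!ltNge => /orP[hx|hx].
      by apply: fejer_ge => //; rewrite ger0_norm// ltW.
    by rewrite -fejer1B; apply: fejer_ge => //; rewrite ger0_norm; lra.
  move=> /(ler_wpM2l (_ : 0 <= 4 / n%:R)); rewrite divr_ge0// => /(_ isT).
  rewrite mulrA mulfVK ?lt0r_neq0//.
  have : 0 <= 64 / n%:R :> R by rewrite divr_ge0.
  by move: (64 / _) (4 / n%:R * _) => ? ?; lra.
move/andP: hx => [hx0 hx1].
apply: le_trans (_ : 64 / n%:R <= _); last by rewrite lerDr mulr_ge0// divr_ge0.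
(* Here 64 is [8 * 8], from [2 pi <= 8] and the loss [8 n]; [fejer_mean_sin] with [q = n ^ 2]
   supplies [1 / n ^ 2]. *)
apply: le_trans (_ : 64 * n%:R * (n ^ 2)%:R^-1 <= _); last first.
  by rewrite natrX expr2 invfM -mulrA mulVKf ?lt0r_neq0.
have n2 : (0 < n ^ 2)%N by rewrite expn_gt0 n0.
have n4 : ((n ^ 2) ^ 2 <= M)%N by rewrite -expnM.
apply: le_trans (ler_wpM2l _ (fejer_mean_sin R x (n ^ 2) M n2 n4)); last by rewrite mulr_ge0.
rewrite -expnM/= mulrCA ler_wpM2l ?invr_ge0// mulr_sumr; apply: ler_sum => j _.
rewrite [leRHS]mulrA (_ : (2 * 2)%N = 4%N)// ler_wpM2r ?fejer_ge0//.
apply: le_trans (norm_cosB _ _ _) _.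
apply: le_trans (huv j) _.
have jM0 : 0 <= j%:R / M%:R :> R by rewrite divr_ge0.
have jM1 : j%:R / M%:R <= 1 :> R by rewrite ler_pdivrMr// mul1r ler_nat ltnW.
have hj : `|x - j%:R / M%:R| <= 1 - (8 * n%:R)^-1.
  by rewrite ler_norml; move: (j%:R / M%:R) jM0 jM1 => y ? ?; apply/andP; split; lra.
have := norm_sinpi_ge R _ _ (introT andP (conj d0 d1)) hj.
have pp := pi_gt0 R.
rewrite ler_pdivrMl ?mulr_gt0// => hs.
have p4 : 2 * pi <= 8 :> R by have := @pihalf_lt2 R; lra.
apply: le_trans (ler_wpM2r (normr_ge0 _) p4) _.
by move: `|sin _| `|x - _| hs => s y; lra.
Qed.

(** * Integrals of trigonometric functions *)

Definition int01 {R : realType} (mu : {measure set R -> \bar R}) (f : R -> R) : R :=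
  \int[mu]_(x in `[0, 1]) f x.

(* The phase [p] lets one real coefficient stand for both the real and the
   imaginary part of the Fourier transform at [m]. *)
Definition cos_coef {R : realType} (mu : {measure set R -> \bar R}) (m p : R) : R :=
  int01 mu (fun x => cos (2 * pi * m * x + p)).

Lemma continuous_integrable01 (R : realType) (mu : {finite_measure set R -> \bar R})
  (f : R -> R) : continuous f -> mu.-integrable `[0, 1] (EFin \o f).
Proof.
move=> cf; apply: measurable_bounded_integrable.
- by [].
- by rewrite -ge0_fin_numE// fin_num_measure.
- by apply: measurable_funTS; exact: continuous_measurable_fun.
- have /compact_bounded[M [_ mrt]] :=
    continuous_compact (continuous_subspaceT cf) (@segment_compact R 0 1).
  by exists M; split; rewrite ?num_real // => ? ? ? ?; exact: mrt.
Qed.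

Lemma int01D (R : realType) (mu : {finite_measure set R -> \bar R}) (f g : R -> R) :
  continuous f -> continuous g ->
  int01 mu (fun x => f x + g x) = int01 mu f + int01 mu g.
Proof. by move=> cf cg; rewrite /int01 RintegralD//; exact: continuous_integrable01. Qed.

Lemma int01Zl (R : realType) (mu : {finite_measure set R -> \bar R}) (r : R) (f : R -> R) :
  continuous f -> int01 mu (fun x => r * f x) = r * int01 mu f.
Proof. by move=> cf; rewrite /int01 RintegralZl//; exact: continuous_integrable01. Qed.

Lemma int01B (R : realType) (mu : {finite_measure set R -> \bar R}) (f g : R -> R) :
  continuous f -> continuous g ->
  int01 mu (fun x => f x - g x) = int01 mu f - int01 mu g.
Proof. by move=> cf cg; rewrite /int01 RintegralB//; exact: continuous_integrable01. Qed.

Lemma le_int01 (R : realType) (mu : {finite_measure set R -> \bar R}) (f g : R -> R) :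
  continuous f -> continuous g -> (forall x, 0 <= x <= 1 -> f x <= g x) ->
  int01 mu f <= int01 mu g.
Proof.
move=> cf cg fg; apply: le_Rintegral => //; try exact: continuous_integrable01.
Qed.

Lemma le_norm_int01 (R : realType) (mu : {finite_measure set R -> \bar R})
  (f g : R -> R) : continuous f -> continuous g ->
  (forall x, 0 <= x <= 1 -> `|f x| <= g x) -> `|int01 mu f| <= int01 mu g.
Proof.
move=> cf cg fg.
apply: le_trans (le_normr_Rintegral _ (continuous_integrable01 R mu f cf)) _ => //.
apply: (le_int01 R mu (fun x => `|f x|) g) => // x.
by apply: continuous_comp; [exact: cf|exact: norm_continuous].
Qed.

Lemma continuous_sumr (R : realType) (I : Type) (r : seq I) (F : I -> R -> R) :
  (forall i, continuous (F i)) -> continuous (fun x => \sum_(i <- r) F i x).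
Proof. by move=> cF; apply: continuous_big => //; exact: add_continuous. Qed.

Lemma continuous_mull (R : realType) (r : R) (f : R -> R) :
  continuous f -> continuous (fun x => r * f x).
Proof. by move=> cf x; apply: continuousM; [exact: cvg_cst|exact: cf]. Qed.

Lemma int01_sum (R : realType) (mu : {finite_measure set R -> \bar R})
  (I : Type) (r : seq I) (F : I -> R -> R) : (forall i, continuous (F i)) ->
  int01 mu (fun x => \sum_(i <- r) F i x) = \sum_(i <- r) int01 mu (F i).
Proof.
move=> cF; elim: r => [|i r IH].
  rewrite big_nil /int01 -[RHS](mul0r (fine (mu `[0, 1]%classic))) -Rintegral_cst//.
  by apply: eq_Rintegral => x _; rewrite big_nil.
rewrite big_cons -IH -int01D//; last exact: continuous_sumr.
by apply: eq_Rintegral => x _; rewrite big_cons.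
Qed.

Lemma continuous_cos_affine (R : realType) (m p : R) :
  continuous (fun x : R => cos (m * x + p)).
Proof.
move=> x; apply: continuous_comp; last exact: continuous_cos.
by apply: continuousD; [exact: (continuous_mull R m id (fun x => cvg_id))|exact: cvg_cst].
Qed.

Lemma cos_coef00 (R : realType) (mu : {measure set R -> \bar R}) :
  cos_coef mu 0 0 = int01 mu (fun=> 1).
Proof.
by apply: eq_Rintegral => x _; rewrite mulr0 mul0r addr0 cos0.
Qed.

(** * Means of cosine coefficients over the nodes *)

Lemma norm_mean_cos_coef (R : realType) (mu : {finite_measure set R -> \bar R})
  (m p r V : R) (M : nat) : (0 < M)%N ->
  (forall p', `|cos_coef mu m p'| <= V) ->
  M%:R^-1 * `|\sum_(j < M) cos_coef mu m (p + 2 * pi * r * (j%:R / M%:R))| <= V.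
Proof.
move=> M0 hV; have MR0 : 0 < M%:R :> R by rewrite ltr0n.
rewrite ler_pdivrMl//; apply: le_trans (ler_norm_sum _ _ _) _.
apply: le_trans (ler_sum _ (fun j _ => hV _)) _.
by rewrite sumr_const card_ord mulr_natl.
Qed.

(** The geometric sum is taken under the integral: [2 sin b * S] is a difference of two coefficients
    at the same frequency [m] with other phases, whence a bound [V] uniform in the phase. The
    condition on [r] puts [b] where [|sin b| >= |r| / M]. *)
Lemma norm_mean_cos_coef_osc (R : realType) (mu : {finite_measure set R -> \bar R})
  (m p r V : R) (M : nat) : (0 < M)%N -> `|r| <= M%:R / 2 ->
  (forall p', `|cos_coef mu m p'| <= V) ->
  M%:R^-1 * `|\sum_(j < M) cos_coef mu m (p + 2 * pi * r * (j%:R / M%:R))| * `|r| <= V.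
Proof.
move=> M0 hr hV; have MR0 : 0 < M%:R :> R by rewrite ltr0n.
have pp := pi_gt0 R.
set S := \sum_(j < M) _.
set b := pi * r / M%:R.
have cj (j : nat) : continuous (fun x : R =>
    cos (2 * pi * m * x + (p + 2 * pi * r * (j%:R / M%:R)))).
  exact: continuous_cos_affine.
have hS : 2 * sin b * S = cos_coef mu m (p + b * (2 * M%:R - 1) - pi / 2)
                        - cos_coef mu m (p - b - pi / 2).
  rewrite /S -(int01_sum R mu _ _ (fun (j : 'I_M) x => cos (2 * pi * m * x + (p + 2 * pi * r * (j%:R / M%:R)))))//.
  rewrite -int01Zl; last by apply: continuous_sumr.
  rewrite -int01B; try exact: continuous_cos_affine.
  apply: eq_Rintegral => x _.
  rewrite !addrA !cosBpihalf -sum_cos_arith; congr (_ * _).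
  by apply: eq_bigr => j _; congr cos; rewrite /b; ring.
have nb : `|b| = pi * `|r| / M%:R.
  by rewrite /b 2!normrM (ger0_norm (ltW pp)) (ger0_norm (_ : 0 <= M%:R^-1)) ?invr_ge0.
have hb2 : `|b| <= pi / 2.
  rewrite nb ler_pdivrMr// -mulrA ler_wpM2l// ?(ltW pp)//.
  by rewrite mulrC.
have hb : `|r| / M%:R <= `|sin b|.
  apply: le_trans (norm_sin_ge_half R b hb2).
  rewrite nb mulrAC ler_wpM2r ?invr_ge0//.
  by have := ler_wpM2r (normr_ge0 r) (pi_ge2 R); lra.
have h2 : 2 * (`|sin b| * `|S|) <= 2 * V.
  rewrite -normrM -{1}(@normr_nat R 2) -normrM mulrA hS.
  apply: le_trans (ler_normB _ _) _.
  by have := hV (p + b * (2 * M%:R - 1) - pi / 2); have := hV (p - b - pi / 2); lra.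
have h3 := ler_wpM2r (normr_ge0 S) hb.
apply: le_trans (_ : `|r| / M%:R * `|S| <= _); last by lra.
by rewrite mulrAC (mulrC `|r|).
Qed.

(** For [|k| <= 3] the trivial bound suffices, as [1 + |k| <= 4]; otherwise
    [|th - k| >= |k| - 1 >= (1 + |k|) / 4] and the oscillation bound applies. *)
Lemma norm_mean_cos_coef_le (R : realType) (mu : {finite_measure set R -> \bar R})
  (m p th k V : R) (M : nat) : (0 < M)%N -> 0 <= th <= 1 -> `|th - k| <= M%:R / 2 ->
  (forall p', `|cos_coef mu m p'| <= V) ->
  M%:R^-1 * `|\sum_(j < M) cos_coef mu m (p + 2 * pi * (th - k) * (j%:R / M%:R))|
    <= 4 * recip1 k * V.
Proof.
move=> M0 /andP[th0 th1] hk hV.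
have h1 := norm_mean_cos_coef R mu m p (th - k) V M M0 hV.
have h2 := norm_mean_cos_coef_osc R mu m p (th - k) V M M0 hk hV.
move: h1 h2; set T := M%:R^-1 * _ => h1 h2.
have T0 : 0 <= T by rewrite mulr_ge0 ?invr_ge0.
have k0 := normr_ge0 k.
rewrite mulrAC /recip1 ler_pdivlMr; last lra.
have [k3|k3] := leP `|k| 3.
  have : T * (1 + `|k|) <= V * 4 by rewrite ler_pM//; lra.
  lra.
have hd : (1 + `|k|) / 4 <= `|th - k|.
  have := ler_normD (th - k) (- th); rewrite normrN (ger0_norm th0).
  by rewrite (_ : th - k - th = - k) ?normrN; [lra|ring].
have := ler_wpM2l T0 hd; lra.
Qed.

(** * Inequalities between powers of the decay weights *)

(** By the triangle inequality the smaller of the weights at [k] and [n + k] is at most twice the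
    weight at [n]. Its power [s] yields the factor in [n]; what remains is at most the larger
    weight, which sums harmonically. *)
Lemma recip1_mul_powR (R : realType) (s k n : R) : 0 <= s <= 1 ->
  recip1 k * recip1 (n + k) `^ s <= 2 * recip1 n `^ s * (recip1 k + recip1 (n + k)).
Proof.
move=> /andP[s0 s1].
have x0 := recip1_gt0 R k; have y0 := recip1_gt0 R (n + k); have z0 := recip1_gt0 R n.
have key : (recip1 n)^-1 <= (recip1 k)^-1 + (recip1 (n + k))^-1.
  rewrite /recip1 !invrK; have := ler_normB (n + k) k; rewrite addrK.
  by have := normr_ge0 k; lra.
move: (recip1 k) (recip1 (n + k)) (recip1 n) x0 y0 z0 key => x y z x0 y0 z0 key.
have s2 : 2 `^ s <= 2 :> R.
  by rewrite -[leRHS]powRr1// ler_powR//; lra.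
have half (a b : R) : 0 < a -> 0 < b -> a <= b -> z^-1 <= a^-1 + b^-1 -> a `^ s <= 2 * z `^ s.
  move=> a0 b0 ab h.
  have ba : b^-1 <= a^-1 by rewrite lef_pV2 ?posrE.
  have az : a <= 2 * z.
    rewrite -[leRHS]invrK -(invrK a) lef_pV2 ?posrE ?invr_gt0 ?mulr_gt0//.
    by rewrite invfM; lra.
  apply: le_trans (_ : (2 * z) `^ s <= _).
    by apply: ge0_ler_powR => //; rewrite nnegrE ?mulr_ge0// ltW.
  by rewrite powRM ?(ltW z0)// ler_wpM2r// powR_ge0.
have zs := powR_ge0 z s.
have [xy|/ltW yx] := leP x y.
  apply: le_trans (_ : 2 * z `^ s * y <= _); last by rewrite ler_wpM2l ?mulr_ge0//; lra.
  have hx : x = x `^ s * x `^ (1 - s).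
    by rewrite -powRD ?subrKC ?powRr1 ?(ltW x0)// lt0r_neq0// implybT.
  have hy : y = y `^ (1 - s) * y `^ s.
    by rewrite -powRD ?subrK ?powRr1 ?(ltW y0)// lt0r_neq0// implybT.
  rewrite [in leRHS]hy {1}hx -mulrA.
  apply: ler_pM; rewrite ?mulr_ge0 ?powR_ge0//; first exact: half key.
  rewrite ler_wpM2r ?powR_ge0//.
  by apply: ge0_ler_powR; rewrite ?nnegrE ?subr_ge0 ?(ltW x0) ?(ltW y0).
apply: le_trans (_ : 2 * z `^ s * x <= _); last by rewrite ler_wpM2l ?mulr_ge0//; lra.
rewrite mulrC ler_wpM2r ?(ltW x0)//; apply: (half y x) => //.
by rewrite addrC.
Qed.

(** Trades the power [s] for the first power, so that the harmonic sum bound applies. *)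
Lemma recip1_powR_le (R : realType) (s w k : R) : s <= 1 -> 0 < w -> w <= recip1 k ->
  recip1 k `^ s <= recip1 k / w `^ (1 - s).
Proof.
move=> s1 w0 wk; have k0 := recip1_gt0 R k.
rewrite ler_pdivlMr ?powR_gt0//.
apply: le_trans (_ : recip1 k `^ s * recip1 k `^ (1 - s) <= _).
  rewrite ler_wpM2l ?powR_ge0//.
  by apply: ge0_ler_powR; rewrite ?nnegrE ?subr_ge0 ?(ltW w0) ?(ltW k0).
by rewrite -powRD ?subrKC ?powRr1 ?(ltW k0)// lt0r_neq0// implybT.
Qed.

(** * Decay at real frequencies *)

Lemma norm_ordB (R : realType) (N : nat) (a b : 'I_N) :
  `|a%:R - b%:R| <= N%:R - 1 :> R.
Proof.
have le (i : 'I_N) : i%:R <= N%:R - 1 :> R.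
  by rewrite lerBrDr natr1 ler_nat ltn_ord.
have := le a; have := le b.
have : 0 <= a%:R :> R by []. have : 0 <= b%:R :> R by [].
by rewrite ler_norml => *; apply/andP; split; lra.
Qed.

(** The integral is an average of coefficients at [a - b] with [|a - b| <= n - 1], where the weight
    is at least [1 / n]; each row is then a harmonic sum. Differences of naturals encode all integer
    frequencies. *)
Lemma int01_fejer_le (R : realType) (mu : {finite_measure set R -> \bar R})
  (C s : R) (n : nat) : (0 < n)%N -> 0 <= C -> s <= 1 ->
  (forall (i j : nat) p,
     `|cos_coef mu (i%:R - j%:R) p| <= C * recip1 (i%:R - j%:R) `^ s) ->
  int01 mu (fejer n) <= 2 * C * harm n / n%:R^-1 `^ (1 - s).
Proof.
move=> n0 C0 s1 H; have nR0 : 0 < n%:R :> R by rewrite ltr0n.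
set w := n%:R^-1; have w0 : 0 < w by rewrite invr_gt0.
have cont (a b : nat) : continuous (fun x : R => cos (2 * pi * (a%:R - b%:R) * x + 0)).
  exact: continuous_cos_affine.
have -> : int01 mu (fejer n) =
    w * \sum_(b < n) \sum_(a < n) cos_coef mu (a%:R - b%:R) 0.
  have -> : fejer n = (fun x : R => w * \sum_(b < n) \sum_(a < n)
      cos (2 * pi * (a%:R - b%:R) * x + 0)).
    apply/funext => x; rewrite /fejer exchange_big/=; congr (_ * _).
    by apply: eq_bigr => b _; apply: eq_bigr => a _; rewrite addr0.
  rewrite int01Zl; last by do 2!apply: continuous_sumr => ?.
  congr (_ * _); rewrite int01_sum; last by move=> b; apply: continuous_sumr.
  by apply: eq_bigr => b _; rewrite int01_sum.
have inner (b : 'I_n) :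
    \sum_(a < n) cos_coef mu (a%:R - b%:R) 0 <= 2 * C * harm n / w `^ (1 - s).
  apply: le_trans (_ : \sum_(a < n) C / w `^ (1 - s) * recip1 (a%:R - b%:R) <= _).
    apply: ler_sum => a _; apply: le_trans (ler_norm _) _.
    apply: le_trans (H a b 0) _; rewrite -mulrA ler_wpM2l// mulrC.
    apply: recip1_powR_le => //; rewrite lef_pV2 ?posrE ?ltr_wpDr//.
    by have := norm_ordB R n a b; lra.
  rewrite -mulr_sumr.
  have D0 : 0 <= C / w `^ (1 - s) by rewrite divr_ge0 ?powR_ge0.
  have := ler_wpM2l D0 (sum_recip1_le R n b%:R).
  by move: (w `^ _) => W; lra.
rewrite ler_pdivrMl//.
apply: le_trans (ler_sum _ (fun b _ => inner b)) _.
by rewrite sumr_const card_ord -[leLHS]mulr_natl.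
Qed.

(* The product of a cosine with [fejer N] is a sum of cosines [cosM_fejer], and the
   sum over the nodes [j] is geometric; this bounds the coefficient of frequency
   [n + k] by [4 * recip1 k]. *)
Lemma norm_int01_interp (R : realType) (mu : {finite_measure set R -> \bar R})
  (C s th p : R) (n N : nat) : (0 < N)%N -> 0 <= C -> 0 <= s <= 1 ->
  0 <= th <= 1 ->
  (forall (i j : nat) p,
     `|cos_coef mu (i%:R - j%:R) p| <= C * recip1 (i%:R - j%:R) `^ s) ->
  `|int01 mu (fun x => (2 * N)%:R^-1 * \sum_(j < 2 * N)
      cos (2 * pi * n%:R * x + 2 * pi * th * (j%:R / (2 * N)%:R) + p)
      * fejer N (x - j%:R / (2 * N)%:R))|
    <= 32 * C * recip1 n%:R `^ s * harm N.
Proof.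
move=> N0 C0 hs hth H; have NR0 : 0 < N%:R :> R by rewrite ltr0n.
(* Twice the order: [|th - (a - b)| <= 1 + (N - 1) = M / 2], as the oscillation bound requires. *)
set M := (2 * N)%N.
have M0 : (0 < M)%N by rewrite muln_gt0.
have MN : M%:R / 2 = N%:R :> R by rewrite natrM mulrAC divff ?mul1r.
pose G (a b j : nat) x := cos (2 * pi * (n%:R + (a%:R - b%:R)) * x +
  (p + 2 * pi * (th - (a%:R - b%:R)) * (j%:R / M%:R))) : R.
have cG a b j : continuous (G a b j) by exact: continuous_cos_affine.
pose S (a b : nat) := \sum_(j < M) cos_coef mu (n%:R + (a%:R - b%:R))
  (p + 2 * pi * (th - (a%:R - b%:R)) * (j%:R / M%:R)).
rewrite (_ : int01 mu _ = M%:R^-1 * (N%:R^-1 *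
    \sum_(b < N) \sum_(a < N) S a b)); last first.
  transitivity (int01 mu (fun x => M%:R^-1 * (N%:R^-1 *
    \sum_(b < N) \sum_(a < N) \sum_(j < M) G a b j x))).
    apply: eq_Rintegral => x _; congr (_ * _).
    under eq_bigr do rewrite cosM_fejer.
    rewrite -mulr_sumr; congr (_ * _).
    rewrite exchange_big/= [RHS]exchange_big/=; apply: eq_bigr => a _.
    rewrite exchange_big/=; apply: eq_bigr => b _.
    by apply: eq_bigr => j _; rewrite /G; congr cos; ring.
  have c3 (a b : nat) : continuous (fun x => \sum_(j < M) G a b j x).
    by apply: continuous_sumr.
  have c2 (b : nat) : continuous (fun x => \sum_(a < N) \sum_(j < M) G a b j x).
    by apply: continuous_sumr.
  have c1 : continuous (fun x => \sum_(b < N) \sum_(a < N) \sum_(j < M) G a b j x).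
    by apply: continuous_sumr.
  rewrite int01Zl; last exact: continuous_mull.
  rewrite int01Zl//; congr (_ * (_ * _)).
  rewrite int01_sum//; apply: eq_bigr => b _.
  rewrite int01_sum//; apply: eq_bigr => a _.
  by rewrite int01_sum.
have inner (b : 'I_N) : \sum_(a < N) M%:R^-1 * `|S a b|
    <= 32 * C * recip1 n%:R `^ s * harm N.
  (* The factor 8 is 4 from the mean over the nodes times 2 from [recip1_mul_powR]; two harmonic
     sums, each at most [2 * harm N], make it 32. *)
  apply: le_trans (_ : \sum_(a < N) 8 * C * recip1 n%:R `^ s *
    (recip1 (a%:R - b%:R) + recip1 (a%:R - (b%:R - n%:R))) <= _).
    apply: ler_sum => a _.
    have hk : `|th - (a%:R - b%:R)| <= M%:R / 2.
      rewrite MN; apply: le_trans (ler_normB _ _) _.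
      have := norm_ordB R N a b; case/andP: hth => th0 th1.
      by rewrite (ger0_norm th0); lra.
    have hV p' : `|cos_coef mu (n%:R + (a%:R - b%:R)) p'|
        <= C * recip1 (n%:R + (a%:R - b%:R)) `^ s.
      by rewrite addrA -natrD; exact: H.
    apply: le_trans (norm_mean_cos_coef_le R mu _ p th _ _ M M0 hth hk hV) _.
    have -> : a%:R - (b%:R - n%:R) = n%:R + (a%:R - b%:R) :> R by ring.
    have := ler_wpM2l C0 (recip1_mul_powR R s (a%:R - b%:R) n%:R hs).
    move: (recip1 (_ - _)) (recip1 (_ + _)) (recip1 n%:R `^ s) => x y z.
    by move: (y `^ s) => ys; lra.
  rewrite -mulr_sumr big_split/=.
  have D0 : 0 <= 8 * C * recip1 n%:R `^ s by rewrite !mulr_ge0// powR_ge0.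
  have h1 := sum_recip1_le R N b%:R; have h2 := sum_recip1_le R N (b%:R - n%:R).
  have := ler_wpM2l D0 (lerD h1 h2).
  by move: (_ `^ s) => z; lra.
have MR0 : 0 <= M%:R^-1 :> R by rewrite invr_ge0.
rewrite !normrM (ger0_norm MR0) (ger0_norm (ltW (_ : 0 < N%:R^-1))) ?invr_gt0//.
rewrite mulrCA ler_pdivrMl//.
apply: le_trans (ler_wpM2l MR0 (ler_norm_sum _ _ _)) _.
rewrite mulr_sumr.
apply: le_trans (_ : \sum_(b < N) (32 * C * recip1 n%:R `^ s * harm N) <= _).
  apply: ler_sum => b _; apply: le_trans (inner b).
  by rewrite -mulr_sumr ler_wpM2l// ler_norm_sum.
by rewrite sumr_const card_ord -[_ *+ N]mulr_natl.
Qed.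

(** The constant is [32 + 8 + 64]: the interpolating polynomial, the Fejer term of the error, and
    the uniform term of the error. *)
Lemma cos_coef_real_le (R : realType) (mu : {finite_measure set R -> \bar R})
  (C s th p : R) (n : nat) : (0 < n)%N -> 0 <= C -> 0 <= s <= 1 ->
  0 <= th <= 1 ->
  (forall (i j : nat) p,
     `|cos_coef mu (i%:R - j%:R) p| <= C * recip1 (i%:R - j%:R) `^ s) ->
  `|cos_coef mu (n%:R + th) p| <= 104 * C * n%:R^-1 `^ s * harm (n ^ 4).
Proof.
move=> n0 C0 hs hth H; have [s0 s1] := andP hs.
have nR0 : 0 < n%:R :> R by rewrite ltr0n.
have N0 : (0 < n ^ 4)%N by rewrite expn_gt0 n0.
set w := n%:R^-1; have w0 : 0 < w by rewrite invr_gt0.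
have w1 : w <= 1 by rewrite invf_le1// ler1n.
set Hn := harm (n ^ 4).
have Hn1 : 1 <= Hn by exact: harm_ge1.
pose M := (2 * n ^ 4)%N.
pose f x : R := cos (2 * pi * (n%:R + th) * x + p).
(* Only the angle [2 pi th x] is sampled at the nodes; the integer frequency [n] stays exact. *)
pose P x := M%:R^-1 * \sum_(j < M)
      cos (2 * pi * n%:R * x + 2 * pi * th * (j%:R / M%:R) + p)
      * fejer (n ^ 4) (x - j%:R / M%:R) : R.
have hP : `|int01 mu P| <= 32 * C * w `^ s * Hn.
  apply: le_trans (norm_int01_interp R mu C s th p n _ N0 C0 hs hth H) _.
  rewrite ler_wpM2r ?(le_trans ler01 Hn1)// ler_wpM2l ?mulr_ge0//.
  apply: ge0_ler_powR; rewrite ?nnegrE// ?(ltW w0) ?(ltW (recip1_gt0 _ _))//.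
  by rewrite lef_pV2 ?posrE ?ltr_wpDr// ger0_norm// lerDr.
have cfej (N : nat) (y : R) : continuous (fun x => fejer N (x - y)).
  apply: continuous_mull; apply: continuous_sumr => a; apply: continuous_sumr => b.
  have -> : (fun x => cos (2 * pi * (a%:R - b%:R) * (x - y))) =
    (fun x => cos (2 * pi * (a%:R - b%:R) * x + 2 * pi * (a%:R - b%:R) * (- y))).
    by apply/funext => x; congr cos; ring.
  exact: continuous_cos_affine.
have cfej0 : continuous (@fejer R n).
  have -> : @fejer R n = fun x => fejer n (x - 0) by apply/funext => x; rewrite subr0.
  exact: cfej.
have cf : continuous f by exact: continuous_cos_affine.
have cP : continuous P.
  apply: continuous_mull; apply: continuous_sumr => j.
  move=> x; apply: (@continuousM R R (fun x => cos _) (fun x => fejer _ _)); last exact: cfej.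
  move: x.
  have -> : (fun x => cos (2 * pi * n%:R * x + 2 * pi * th * (j%:R / M%:R) + p)) =
    (fun x => cos (2 * pi * n%:R * x + (2 * pi * th * (j%:R / M%:R) + p))).
    by apply/funext => y; congr cos; rewrite addrA.
  exact: continuous_cos_affine.
have hd : `|int01 mu f - int01 mu P| <= 4 * w * int01 mu (fejer n) + 64 * w * int01 mu (fun=> 1).
  have c1 : continuous (fun _ : R => 1 : R) by move=> x; exact: cvg_cst.
  have ca := continuous_mull R (4 * w) _ cfej0.
  have cb := continuous_mull R (64 * w) _ c1.
  rewrite -int01B// -int01Zl// -int01Zl// -(int01D _ _ _ _ ca cb).
  apply: le_norm_int01.
  - by move=> x; apply: continuousB; [exact: cf|exact: cP].
  - by move=> x; exact: (cvgD (ca x) (cb x)).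
  move=> x x01; rewrite mulr1.
  apply: (cos_fejer_approx R n x _
    (fun j => 2 * pi * n%:R * x + 2 * pi * th * (j%:R / M%:R) + p) M) => //.
    by rewrite /M leq_pmull.
  move=> j.
  rewrite (_ : _ - _ = 2 * pi * th * (x - j%:R / M%:R)); last by ring.
  have [th0 th1] := andP hth.
  rewrite normrM ler_wpM2r// normrM (ger0_norm th0) ger0_norm ?mulr_ge0 ?pi_ge0//.
  by rewrite ler_piMr// mulr_ge0 ?pi_ge0.
(* The total mass is the coefficient at frequency 0, where the weight is 1. *)
have h1 : int01 mu (fun=> 1) <= C.
  have := H 0%N 0%N 0; rewrite subrr cos_coef00 /recip1 normr0 addr0 invr1 powR1 mulr1.
  by apply: le_trans; rewrite ler_norm.
have h2 := int01_fejer_le R mu C s n n0 C0 s1 H.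
have hw : w / w `^ (1 - s) = w `^ s.
  apply: (mulIf (lt0r_neq0 (powR_gt0 (1 - s) w0))).
  rewrite divfK ?lt0r_neq0 ?powR_gt0// -powRD ?subrKC ?powRr1 ?(ltW w0)//.
  by rewrite lt0r_neq0// implybT.
have h3 : 4 * w * int01 mu (fejer n) <= 8 * C * w `^ s * Hn.
  have w4 : 0 <= 4 * w by rewrite mulr_ge0 ?(ltW w0).
  apply: le_trans (ler_wpM2l w4 h2) _.
  have -> : 4 * w * (2 * C * harm n / w `^ (1 - s)) = 8 * C * (w / w `^ (1 - s)) * harm n by ring.
  rewrite hw ler_wpM2l ?mulr_ge0 ?powR_ge0//; apply: le_harm.
  by rewrite -{1}(expn1 n) leq_pexp2l.
have h4 : 64 * w * int01 mu (fun=> 1) <= 64 * C * w `^ s * Hn.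
  apply: le_trans (_ : 64 * w * C <= _); first by rewrite ler_wpM2l ?mulr_ge0 ?(ltW w0).
  apply: le_trans (_ : 64 * w `^ s * C * 1 <= _).
    rewrite mulr1 ler_wpM2r// ler_wpM2l//; apply: ger1_powR => //.
    by rewrite w0 w1.
  by rewrite [leRHS](_ : _ = 64 * w `^ s * C * Hn); [rewrite ler_wpM2l ?mulr_ge0 ?powR_ge0|ring].
have -> : cos_coef mu (n%:R + th) p = int01 mu P + (int01 mu f - int01 mu P) by rewrite subrKC.
apply: le_trans (ler_normD _ _) _.
by move: `|_| `|_| hP hd h3 h4 => u v; lra.
Qed.

(** * Cosine coefficients and the Fourier transform *)

Lemma cos_coefE (R : realType) (mu : {finite_measure set R -> \bar R}) (z p : R) :
  cos_coef mu z p = cos p * cos_coef mu z 0 + sin p * cos_coef mu z (pi / 2).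
Proof.
have c q : continuous (fun x : R => cos (2 * pi * z * x + q)).
  exact: continuous_cos_affine.
rewrite /cos_coef -int01Zl// -int01Zl//.
rewrite -(int01D _ _ _ _ (continuous_mull R _ _ (c _)) (continuous_mull R _ _ (c _))).
by apply: eq_Rintegral => x _; rewrite addr0 cosDpihalf cosD; ring.
Qed.

(** Phases 0 and [pi / 2] give exactly the real and the imaginary part. *)
Lemma fourier_sqrE (R : realType) (mu : {finite_measure set R -> \bar R}) (z : R) :
  fourier_sqr mu z = cos_coef mu z 0 ^+ 2 + cos_coef mu z (pi / 2) ^+ 2.
Proof.
rewrite /fourier_sqr /fourier /cintegral /= sqr_sqrtr ?addr_ge0 ?sqr_ge0//.
congr (_ ^+ 2 + _ ^+ 2); apply: eq_Rintegral => x _.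
  by rewrite cosN addr0.
by rewrite sinN cosDpihalf.
Qed.

Lemma fourier_sqr_ge0 (R : realType) (mu : {finite_measure set R -> \bar R}) (z : R) :
  0 <= fourier_sqr mu z.
Proof. by rewrite fourier_sqrE addr_ge0 ?sqr_ge0. Qed.

(** Cauchy-Schwarz against the unit vector [(cos p, sin p)], through Lagrange's identity. *)
Lemma cos_coef_sqr_le (R : realType) (mu : {finite_measure set R -> \bar R}) (z p : R) :
  cos_coef mu z p ^+ 2 <= fourier_sqr mu z.
Proof.
rewrite cos_coefE fourier_sqrE; have := cos2Dsin2 p.
move: (cos p) (sin p) (cos_coef _ _ 0) (cos_coef _ _ (pi / 2)) => c s a b e.
have -> : a ^+ 2 + b ^+ 2 = (c ^+ 2 + s ^+ 2) * (a ^+ 2 + b ^+ 2) by rewrite e mul1r.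
rewrite -subr_ge0.
have -> : (c ^+ 2 + s ^+ 2) * (a ^+ 2 + b ^+ 2) - (c * a + s * b) ^+ 2 = (c * b - s * a) ^+ 2.
  by ring.
exact: sqr_ge0.
Qed.

Lemma fourier_sqrN (R : realType) (mu : {finite_measure set R -> \bar R}) (z : R) :
  fourier_sqr mu (- z) = fourier_sqr mu z.
Proof.
rewrite !fourier_sqrE; congr (_ + _).
  congr (_ ^+ 2); apply: eq_Rintegral => x _.
  by rewrite !addr0 mulrN mulNr cosN.
rewrite -sqrrN; congr (_ ^+ 2); rewrite -mulN1r -int01Zl; last exact: continuous_cos_affine.
apply: eq_Rintegral => x _; rewrite !cosDpihalf mulN1r opprK -sinN.
by congr sin; ring.
Qed.

Lemma norm_cos_coef_le (R : realType) (mu : {finite_measure set R -> \bar R}) (z p : R) :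
  `|cos_coef mu z p| <= int01 mu (fun=> 1).
Proof.
apply: le_norm_int01.
- exact: continuous_cos_affine.
- by move=> x; exact: cvg_cst.
- by move=> x _; exact: cos_max.
Qed.

Lemma fourier_sqr_le (R : realType) (mu : {finite_measure set R -> \bar R}) (z : R) :
  fourier_sqr mu z <= 2 * int01 mu (fun=> 1) ^+ 2.
Proof.
have h p : cos_coef mu z p ^+ 2 <= int01 mu (fun=> 1) ^+ 2.
  have H := norm_cos_coef_le R mu z p.
  by rewrite -real_normK ?num_real// ler_sqr ?nnegrE// (le_trans _ H).
by rewrite fourier_sqrE; have := h 0; have := h (pi / 2); lra.
Qed.

(** Puts [D = 0] in both sets of exponents, so neither supremum is over the empty set. The general
    filter and [g] cover real and integer frequencies at once. *)
Lemma fourier_sqr_O1 (R : realType) (mu : {finite_measure set R -> \bar R})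
  (T : Type) (F : filter_on T) (g h : T -> R) :
  (fun t => fourier_sqr mu (g t)) =O_F (fun t => h t `^ (- 0)).
Proof.
have B0 : 0 <= 2 * int01 mu (fun=> 1) ^+ 2 by rewrite mulr_ge0 ?sqr_ge0.
apply/eqO_exP; exists (2 * int01 mu (fun=> 1) ^+ 2 + 1); first by lra.
apply: filterE => t; rewrite oppr0 powRr0 normr1 mulr1 ger0_norm ?fourier_sqr_ge0//.
by have := fourier_sqr_le R mu (g t); lra.
Qed.

(** * Transfer of the decay rate from integer to real frequencies *)

Lemma invr_powR (R : realType) (x r : R) : 0 <= x -> x^-1 `^ r = x `^ (- r).
Proof. by move=> x0; rewrite -powR_inv1// -powRrM mulN1r. Qed.

Lemma powR2M_le (R : realType) (x r : R) : 0 <= x -> r <= 1 ->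
  (2 * x) `^ r <= 2 * x `^ r.
Proof.
move=> x0 r1; rewrite powRM// ler_wpM2r ?powR_ge0//.
by rewrite -[leRHS]powRr1// ler_powR//; lra.
Qed.

(** Turns a bound for large naturals into one for all integers: evenness handles the sign, and the
    total mass handles [l <= n0]. For large [l], [1 + 2 * k] replaces a square root, since
    [2 k <= (1 + 2 k) ^ 2]. *)
Lemma cos_coef_decay (R : realType) (mu : {finite_measure set R -> \bar R})
  (D k : R) (n0 : nat) : 0 <= D <= 1 -> 0 <= k ->
  (forall n : nat, (n0 <= n)%N -> fourier_sqr mu n%:R <= k * n%:R `^ (- D)) ->
  exists2 C : R, 0 <= C & forall (i j : nat) p,
    `|cos_coef mu (i%:R - j%:R) p| <= C * recip1 (i%:R - j%:R) `^ (D / 2).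
Proof.
move=> /andP[D0 D1] k0 hk.
set B := int01 mu (fun=> 1).
have B0 : 0 <= B by apply: le_trans (norm_cos_coef_le R mu 0 0).
exists (B * n0.+2%:R + (1 + 2 * k)); first by rewrite addr_ge0 ?mulr_ge0//; lra.
move=> i j p.
have [l hl] : exists l : nat, `|i%:R - j%:R| = l%:R :> R /\
    (i%:R - j%:R = l%:R :> R \/ i%:R - j%:R = - l%:R :> R).
  have [ij|/ltnW ij] := leqP j i.
    by exists (i - j)%N; rewrite natrB// ger0_norm ?subr_ge0 ?ler_nat//; split => //; left.
  exists (j - i)%N; rewrite natrB//; split; last by right; rewrite opprB.
  by rewrite distrC ger0_norm ?subr_ge0 ?ler_nat.
case: hl => hl1 hl2.
have fl : fourier_sqr mu (i%:R - j%:R) = fourier_sqr mu l%:R.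
  by case: hl2 => ->//; rewrite fourier_sqrN.
have -> : recip1 (i%:R - j%:R) = recip1 l%:R :> R by rewrite /recip1 hl1 normr_nat.
have r0 := recip1_gt0 R l%:R; have r1 := recip1_le1 R l%:R.
have rs0 := powR_ge0 (recip1 l%:R : R) (D / 2).
rewrite mulrDl.
have [ln|nl] := leqP l n0.
  apply: le_trans (norm_cos_coef_le R mu _ _) _; rewrite -/B.
  apply: le_trans (_ : B * n0.+2%:R * recip1 l%:R `^ (D / 2) <= _); last first.
    by rewrite lerDl mulr_ge0//; lra.
  rewrite -mulrA ler_peMr//.
  apply: le_trans (_ : n0.+2%:R * recip1 l%:R <= _); last first.
    by rewrite ler_wpM2l// ger1_powR ?r0 ?r1//; lra.
  rewrite /recip1 normr_nat ler_pdivlMr ?ltr_wpDr// mul1r.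
  by rewrite addrC natr1 ler_nat ltnW.
have l0 : (0 < l)%N by apply: leq_ltn_trans nl.
have lR0 : 0 < l%:R :> R by rewrite ltr0n.
apply: le_trans (_ : (1 + 2 * k) * recip1 l%:R `^ (D / 2) <= _); last first.
  by rewrite lerDr !mulr_ge0.
have h2k : 0 <= (1 + 2 * k) * recip1 l%:R `^ (D / 2) by rewrite mulr_ge0//; lra.
rewrite -ler_sqr ?nnegrE// real_normK ?num_real//.
apply: le_trans (cos_coef_sqr_le R mu _ _) _; rewrite fl.
apply: le_trans (hk l (ltnW nl)) _.
rewrite exprMn -[_ `^ (D / 2) ^+ 2]powR_mulrn// -powRrM divfK//.
apply: le_trans (_ : k * (2 * recip1 l%:R `^ D) <= _).
  rewrite ler_wpM2l// -invr_powR//.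
  apply: le_trans (powR2M_le R _ _ (ltW r0) D1).
  apply: ge0_ler_powR; rewrite ?nnegrE ?invr_ge0 ?mulr_ge0 ?(ltW r0)//.
  rewrite /recip1 normr_nat -[leRHS]invrK lef_pV2 ?posrE ?invr_gt0 ?mulr_gt0 ?invr_gt0 ?ltr_wpDr//.
  have : 1 <= l%:R :> R by rewrite ler1n.
  by rewrite invfM invrK; lra.
rewrite mulrA ler_wpM2r ?powR_ge0//.
by have := sqr_ge0 k; rewrite sqrrD expr1n; have := sqr_ge0 (2 * k); lra.
Qed.

(** Absorbs the logarithm: [ln (n ^ 4) = (4 / e) ln (n ^ e)], and [ln] is below the identity. *)
Lemma harm_exp_le (R : realType) (e : R) (n : nat) : 0 < e -> (0 < n)%N ->
  harm (n ^ 4) <= (1 + 4 / e) * n%:R `^ e.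
Proof.
move=> e0 n0; have nR0 : 0 < n%:R :> R by rewrite ltr0n.
apply: le_trans (harm_le_ln R _ _) _; first by rewrite expn_gt0 n0.
have p1 : 1 <= n%:R `^ e by rewrite -[leLHS](powRr0 n%:R) ler_powR ?ler1n// ltW.
have := ln_sublinear (powR_gt0 e nR0); rewrite ln_powR => /ltW h.
rewrite natrX lnXn// mulrDl mul1r lerD//.
rewrite -[_ *+ 4]mulr_natl -mulrA ler_wpM2l//.
by rewrite mulrC ler_pdivlMr// mulrC.
Qed.

Lemma fourier_sqr_decay (R : realType) (mu : {finite_measure set R -> \bar R})
  (D D' k : R) (n0 : nat) : 0 <= D' -> D' < D -> D <= 1 -> 0 <= k ->
  (forall n : nat, (n0 <= n)%N -> fourier_sqr mu n%:R <= k * n%:R `^ (- D)) ->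
  exists K : R, forall z : R, 1 <= `|z| -> fourier_sqr mu z <= K * `|z| `^ (- D').
Proof.
move=> D'0 D'D D1 k0 hk.
have hD : 0 <= D <= 1 by lra.
have [C C0 hC] := cos_coef_decay R mu D k n0 hD k0 hk.
(* Half the loss in the exponent, because [cos_coef] decays at half the rate of [fourier_sqr]. *)
pose e := (D - D') / 2; have e0 : 0 < e by rewrite /e; lra.
pose L := 104 * C * (1 + 4 / e).
have L0 : 0 <= L by rewrite !mulr_ge0// addr_ge0// divr_ge0// ltW.
(* One factor 2 comes from [z <= 2 n] with [n] the integer part of [z], the other from the two
   phases in [fourier_sqrE]. *)
exists (4 * L ^+ 2) => z z1.
have -> : fourier_sqr mu z = fourier_sqr mu `|z|.
  by case: (ger0P z) => _ //; rewrite fourier_sqrN.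
move: `|z| z1 => {}z z1.
have z0 : 0 <= z by lra.
have /andP[nz zn] := truncn_itv z0.
set n := Num.truncn z in nz zn.
have n0' : (0 < n)%N by rewrite -(ltr_nat R); rewrite -natr1 in zn; lra.
have nR1 : 1 <= n%:R :> R by rewrite ler1n.
have nR0 : 0 < n%:R :> R by lra.
have w0 : 0 < n%:R^-1 :> R by rewrite invr_gt0.
have hs : 0 <= D / 2 <= 1 by lra.
have hth : 0 <= z - n%:R <= 1 by rewrite -natr1 in zn; lra.
have ez : n%:R + (z - n%:R) = z by rewrite subrKC.
have hw : n%:R^-1 `^ (D / 2) * n%:R `^ e = n%:R^-1 `^ (D' / 2).
  have -> : n%:R `^ e = n%:R^-1 `^ (- e) by rewrite invr_powR ?opprK.
  rewrite -powRD ?lt0r_neq0 ?implybT//; congr (_ `^ _); rewrite /e; lra.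
have hc p : cos_coef mu z p ^+ 2 <= L ^+ 2 * (2 * z `^ (- D')).
  apply: le_trans (_ : (L * n%:R^-1 `^ (D' / 2)) ^+ 2 <= _).
    have Lw : 0 <= L * n%:R^-1 `^ (D' / 2) by apply: mulr_ge0 => //; exact: powR_ge0.
    rewrite -(real_normK (num_real (cos_coef _ _ _))) ler_sqr ?nnegrE//.
    have := cos_coef_real_le R mu C (D / 2) (z - n%:R) p n n0' C0 hs hth hC.
    rewrite ez => h; apply: le_trans h _.
    have D0 : 0 <= 104 * C * n%:R^-1 `^ (D / 2) by rewrite !mulr_ge0 ?powR_ge0.
    apply: le_trans (ler_wpM2l D0 (harm_exp_le R e n e0 n0')) _.
    rewrite -hw /L le_eqVlt; apply/orP; left; apply/eqP.
    by move: (_ `^ _) (_ `^ _) (4 / e) => u v t; ring.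
  rewrite exprMn ler_wpM2l ?sqr_ge0//.
  rewrite -powR_mulrn ?powR_ge0// -powRrM divfK// -invr_powR//.
  have D'1 : D' <= 1 by lra.
  have zi0 : 0 <= z^-1 by rewrite invr_ge0.
  apply: le_trans (powR2M_le R _ _ zi0 D'1).
  apply: ge0_ler_powR; rewrite ?nnegrE ?mulr_ge0 ?(ltW w0)//.
  rewrite -[leRHS]invrK lef_pV2 ?posrE ?invr_gt0 ?mulr_gt0 ?invr_gt0//; last lra.
  by rewrite invfM invrK; rewrite -natr1 in zn; lra.
rewrite fourier_sqrE; have := hc 0; have := hc (pi / 2); lra.
Qed.

(** * Comparison of the two suprema *)

(** If some [D] in [E] exceeded [sup F], the midpoint of the two would lie in [F] above its
    supremum. An arbitrarily small loss in the exponent is therefore harmless. *)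
Lemma sup_le_of_lt (R : realType) (E F : set R) :
  E 0 -> F 0 -> (forall D, F D -> D <= 1) ->
  (forall D D', E D -> 0 <= D' -> D' < D -> F D') -> sup E <= sup F.
Proof.
move=> E0 F0 F1 EF.
have ubF : has_ubound F by exists 1 => x; exact: F1.
apply: ge_sup; first by exists 0.
move=> D ED; rewrite leNgt; apply/negP => DF.
have s0 : 0 <= sup F by exact: ub_le_sup.
have : F ((sup F + D) / 2) by apply: (EF D) => //; lra.
move=> /(ub_le_sup ubF); lra.
Qed.

Theorem lemma1p8 (R : realType) (mu : {finite_measure set R -> \bar R})
    (mu_supp : mu (~` `[0, 1]) = 0%E) (mu_neq0 : mu `[0, 1]%classic != 0%E) :
  fourier_dim mu =
  sup [set D : R | 0 <= D < 1 /\
    (fun n : nat => fourier_sqr mu n%:R) =O_\oo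
    (fun n : nat => n%:R `^ (- D))].
Proof.
apply/eqP; rewrite eq_le; apply/andP; split; apply: sup_le_of_lt => /=.
- split; [by rewrite lexx ler01|exact: fourier_sqr_O1].
- split; [by rewrite lexx ltr01|exact: fourier_sqr_O1].
- by move=> D [] /andP[_ /ltW].
(* From real to integer frequencies by restriction; lowering [D <= 1] to [D'] gives the strict
   inequality [D' < 1]. *)
- move=> D D' [/andP[D0 D1] /eqO_exP[k k0 [M _ hM]]] D'0 D'D; split; first by lra.
  apply/eqO_exP; exists k => //.
  near=> n.
  have n1 : 1 <= n%:R :> R by near: n; exact: nbhs_infty_ger.
  have Mn : M <= `|n%:R| by rewrite normr_nat; near: n; exact: nbhs_infty_ger.
  apply: le_trans (hM _ Mn) _; rewrite ler_wpM2l ?(ltW k0)// normr_nat.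
  rewrite !ger0_norm ?powR_ge0// ler_powR//; lra.
- split; [by rewrite lexx ltr01|exact: fourier_sqr_O1].
- split; [by rewrite lexx ler01|exact: fourier_sqr_O1].
- by move=> D [] /andP[].
- move=> D D' [/andP[D0 D1] /eqO_exP[k k0 [n0 _ hn]]] D'0 D'D; split; first by lra.
  have hk n : (n0 <= n)%N -> fourier_sqr mu n%:R <= k * n%:R `^ (- D).
    by move=> /hn /=; rewrite ger0_norm ?fourier_sqr_ge0// ger0_norm ?powR_ge0.
  have [K hK] := fourier_sqr_decay R mu D D' k n0 D'0 D'D (ltW D1) (ltW k0) hk.
  (* The big-O constant must be positive, and [K] has no known sign. *)
  apply/eqO_exP; exists (`|K| + 1); first by rewrite ltr_wpDl.
  exists 1 => // z /= z1; rewrite (ger0_norm (fourier_sqr_ge0 _ _ _)) (ger0_norm (powR_ge0 _ _)).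
  apply: le_trans (hK z z1) _; rewrite ler_wpM2r ?powR_ge0//.
  by have := ler_norm K; lra.
Unshelve. all: by end_near. Qed.
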